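(* Let $p>0$, and let $Y,Z\in\mathbb{R}^N$ be two vectors with positive entries, $Y$ not constant. Let $\mu$ and $\mu^*$ be the probability measures on $[0,1]$ associated with $(Y,Z)$. Then $$\mathrm{WRGX}_p(Y,Z)=1-\frac{\mathrm{CvM}_p(\mu,\mu^* )}{\int_0^1|L_Y^c(t)-L_Y(t)|^p\,d\mu(t)},$$ where the curves $L_Y$, $L_Y^c$ are normalized by $\sum_{i=1}^NY_i$.
   Context: The ordering induced by a vector $V\in\mathbb{R}^N$ is the permutation $s$ of $\{1,\dots,N\}$ with $V_{s_1}\le\dots\le V_{s_N}$ (ties broken by a fixed rule). Let $r$ be the ordering induced by $Y$, $r^*$ the ordering induced by $Z$, and $N\bar Y=\sum_{i=1}^NY_i$. Define three piecewise linear functions on $[0,1]$ by interpolation at the nodes $k/N$, $k=0,\dots,N$ (normalized versions): $L_Y(k/N)=\frac{1}{N\bar Y}\sum_{i=1}^kY_{r_i}$, $L_Y^c(k/N)=\frac{1}{N\bar Y}\sum_{i=1}^kY_{r_{N+1-i}}$, $L_{Y,Z}(k/N)=\frac{1}{N\bar Y}\sum_{i=1}^kY_{r^*_i}$. Let $\Delta_{i/N}$ be the probability measure with density $N\,\mathbb{I}_{[\frac{i-1}{N},\frac iN]}$, and set $$\mu=\sum_{i=1}^N\frac{Y_{r_i}}{N\bar Y}\Delta_{\frac iN},\qquad \mu^*=\sum_{i=1}^N\frac{Y_{r_i^*}}{N\bar Y}\Delta_{\frac iN}.$$ The weighted metric is $$\mathrm{WRGX}_p(Y,Z)=1-\frac{\int_0^1|L_{Y,Z}(t)-L_Y(t)|^p\,d\mu(t)}{\int_0^1|L_Y^c(t)-L_Y(t)|^p\,d\mu(t)}.$$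 For probability measures $\alpha,\beta$ on $\mathbb{R}$ with c.d.f.s $F_\alpha,F_\beta$, the $p$-th order Cramér–von Mises divergence is $\mathrm{CvM}_p(\alpha,\beta)=\int_{\mathbb{R}}|F_\alpha(u)-F_\beta(u)|^p\,dF_\alpha(u)$. *)

(* Defs.v *)
From HB Require Import structures.
From mathcomp Require Export all_boot all_order all_algebra perm.
From mathcomp Require Export all_classical all_reals all_analysis.

From mathcomp Require Import ring.

Set Implicit Arguments.
Unset Strict Implicit.
Unset Printing Implicit Defensive.

Export Order.TTheory GRing.Theory Num.Theory.
Export numFieldNormedType.Exports.

#[global] Open Scope classical_set_scope.
#[global] Open Scope ring_scope.

(* Indices 1, ..., N are rendered 0-based by 'I_N.  An ordering rule picks, for
   every vector, one of the permutations sorting it; the choice among these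
   permutations is the tie-breaking convention. *)
Definition ordering_rule (R : realType) (N : nat) (ord : 'rV[R]_N -> 'S_N) :=
  forall (V : 'rV[R]_N) (i j : 'I_N),
    (i <= j)%N -> V 0 (ord V i) <= V 0 (ord V j).

Section Curves.
Context {R : realType} {N : nat}.

(* Linear interpolation on [0, 1] of the values v k at the nodes k / N.  At
   t = 1 the integer part is N and the slope term, which involves v N.+1,
   vanishes. *)
Definition interp (v : nat -> R) (t : R) : R :=
  let k := Num.truncn (N%:R * t) in
  v k + (N%:R * t - k%:R) * (v k.+1 - v k).

Lemma interpE (v : nat -> R) (k : nat) (t : R) :
  (0 < N)%N -> k%:R / N%:R <= t <= k.+1%:R / N%:R ->
  interp v t = (k.+1%:R - N%:R * t) * v k + (N%:R * t - k%:R) * v k.+1.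
Proof.
move=> N0; have N0R : (0 : R) < N%:R by rewrite ltr0n.
rewrite ler_pdivrMr // ler_pdivlMr // [t * _]mulrC => /andP[kt].
rewrite le_eqVlt => /orP[/eqP e|tk].
  by rewrite /interp e natrK; ring.
have -> : interp v t = v k + (N%:R * t - k%:R) * (v k.+1 - v k).
  by rewrite /interp (_ : Num.truncn _ = k) //; apply: truncn_def; rewrite kt.
by rewrite -natr1; ring.
Qed.

Definition total (Y : 'rV[R]_N) : R := \sum_(i < N) Y 0 i.

Definition curve (Y : 'rV[R]_N) (s : 'I_N -> 'I_N) : R -> R :=
  interp (fun k => (total Y)^-1 * \sum_(i < N | (i < k)%N) Y 0 (s i)).

Variable ord : 'rV[R]_N -> 'S_N.

Definition L_ (Y : 'rV[R]_N) : R -> R := curve Y (ord Y).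

Definition Lc_ (Y : 'rV[R]_N) : R -> R :=
  curve Y (fun i => ord Y (rev_ord i)).

Definition L2_ (Y Z : 'rV[R]_N) : R -> R := curve Y (ord Z).

End Curves.

Section Mixture.
Context d {T : measurableType d} {R : realType} {N : nat}.
Variables (w : 'I_N -> R) (m : 'I_N -> probability T R).

(* The proofs w0 and w1 do not occur in the body; the probability instance
   below depends on them. *)
Definition mixture (w0 : forall i, 0 <= w i) (w1 : \sum_(i < N) w i = 1)
  (A : set T) : \bar R := (\sum_(i < N) (w i)%:E * m i A)%E.

Hypotheses (w0 : forall i, 0 <= w i) (w1 : \sum_(i < N) w i = 1).

Let component (k : nat) : {measure set T -> \bar R} :=
  if insub k is Some i then mscale (NngNum (w0 i)) (m i) else mzero.

Let mixtureE : mixture w0 w1 = msum component N.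
Proof.
by apply/funext => A; apply: eq_bigr => i _; rewrite /component valK.
Qed.

Let mixture0 : mixture w0 w1 set0 = 0%E.
Proof. by rewrite mixtureE measure0. Qed.

Let mixture_ge0 A : (0 <= mixture w0 w1 A)%E.
Proof. by rewrite mixtureE measure_ge0. Qed.

Let mixture_sigma_additive : semi_sigma_additive (mixture w0 w1).
Proof. by rewrite mixtureE; exact: measure_semi_sigma_additive. Qed.

HB.instance Definition _ := isMeasure.Build _ _ _ (mixture w0 w1)
  mixture0 mixture_ge0 mixture_sigma_additive.

Let mixture_setT : mixture w0 w1 setT = 1%E.
Proof.
rewrite /mixture; under eq_bigr do rewrite probability_setT mule1.
by rewrite sumEFin w1.
Qed.

HB.instance Definition _ := @Measure_isProbability.Build _ _ R
  (mixture w0 w1) mixture_setT.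

End Mixture.

Section Measures.
Context {R : realType} {N : nat}.

Lemma node_lt (i : 'I_N) : i%:R / N%:R < i.+1%:R / N%:R :> R.
Proof.
have N0 : (0 < N)%N by apply: leq_trans (ltn_ord i).
by rewrite ltr_pM2r ?ltr_nat // invr_gt0 ltr0n.
Qed.

(* The 0-based index i gives the measure Delta_{(i+1)/N}. *)
Definition Delta (i : 'I_N) : probability (measurableTypeR R) R :=
  uniform_prob (node_lt i).

Lemma DeltaE (i : 'I_N) (A : set R) :
  Delta i A = (\int[lebesgue_measure]_(x in A)
    (N%:R * \1_(`[i%:R / N%:R, i.+1%:R / N%:R]%classic) x)%:E)%E.
Proof.
have N0 : (0 < N)%N by apply: leq_trans (ltn_ord i).
apply: eq_integral => x _; congr (_%:E).
rewrite /uniform_pdf indicE mem_setE in_itv /=.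
case: ifP => _; rewrite ?mulr0 // mulr1 -mulrBl -natrB // subSnn mul1r.
by rewrite invrK.
Qed.

Variables (Y : 'rV[R]_N).
Hypotheses (hN : (0 < N)%N) (hY : forall i, 0 < Y 0 i).

Lemma total_gt0 : 0 < total Y.
Proof.
rewrite /total (bigD1 (Ordinal hN)) //= ltr_pwDl // sumr_ge0 // => i _.
exact: ltW.
Qed.

Lemma weight_ge0 (s : 'S_N) (i : 'I_N) : 0 <= Y 0 (s i) / total Y.
Proof. by rewrite divr_ge0 // ltW // total_gt0. Qed.

Lemma weight_sum1 (s : 'S_N) : \sum_(i < N) Y 0 (s i) / total Y = 1.
Proof.
have e : \sum_(i < N) Y 0 (s i) = total Y.
  by rewrite /total [RHS](reindex_inj (@perm_inj _ s)).
by rewrite -mulr_suml e divff // gt_eqF // total_gt0.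
Qed.

Definition mu_ (s : 'S_N) : probability (measurableTypeR R) R :=
  mixture Delta (weight_ge0 s) (weight_sum1 s).

End Measures.

Section CramerVonMises.
Context {R : realType}.

Definition idR : measurableTypeR R -> R := idfun.

HB.instance Definition _ :=
  @isMeasurableFun.Build _ _ _ _ idR (@measurable_id _ _ setT).

Definition Fcdf (a : probability (measurableTypeR R) R) (u : R) : R :=
  fine (cdf (idR : {RV a >-> R}) u).

Lemma FcdfE a u : Fcdf a u = fine (a `]-oo, u]%classic).
Proof. by []. Qed.

Section Cumulative.
Variable a : probability (measurableTypeR R) R.

Let Fcdf_nd : nondecreasing (Fcdf a).
Proof. by move=> *; rewrite fine_le ?fin_num_measure // cdf_nondecreasing. Qed.

Let Fcdf_rc : right_continuous (Fcdf a).
Proof.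
move=> x; apply: fine_cvg.
by rewrite fineK ?fin_num_measure //; exact: cdf_right_continuous.
Qed.

HB.instance Definition _ := isCumulative.Build R _ R (Fcdf a) Fcdf_nd Fcdf_rc.

End Cumulative.

(* dF_a is the Lebesgue-Stieltjes measure of the c.d.f. of a. *)
Definition CvM (p : R) (a b : probability (measurableTypeR R) R) : R :=
  \int[lebesgue_stieltjes_measure (Fcdf a)]_(u in setT)
    (`|Fcdf a u - Fcdf b u| `^ p).

End CramerVonMises.

Definition WRGX (R : realType) (N : nat) (ord : 'rV[R]_N -> 'S_N) (p : R)
    (Y Z : 'rV[R]_N) (hN : (0 < N)%N) (hY : forall i, 0 < Y 0 i) : R :=
  1 - (\int[mu_ hN hY (ord Y)]_(t in `[0, 1])
         (`|L2_ ord Y Z t - L_ ord Y t| `^ p)) /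
      (\int[mu_ hN hY (ord Y)]_(t in `[0, 1])
         (`|Lc_ ord Y t - L_ ord Y t| `^ p)).

(* Main.v *)
Require Import Defs.
From mathcomp Require Import ring lra.

(* The c.d.f. of mu_ s is the curve of Y along s: Delta_((i+1)/N) has c.d.f.
   u |-> min(1, max(0, N u - i)), and the weighted sum of these ramps is the
   piecewise linear interpolation on [0, 1].  Outside [0, 1] the c.d.f.s of mu
   and mustar agree (both 0 or both 1), so the integrand of CvM vanishes there
   because 0 `^ p = 0 for p > 0; and the Lebesgue-Stieltjes measure of the
   c.d.f. of mu is mu itself. *)

(** The c.d.f. of the uniform law on [0, 1]. *)
Definition clamp01 {R : realType} (x : R) : R := Num.min 1 (Num.max 0 x).

Lemma uniform_prob_ray (R : realType) (a b : R) (ab : a < b) (u : R) :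
  uniform_prob ab `]-oo, u] = (clamp01 ((u - a) / (b - a)))%:E.
Proof.
have ba0 : 0 < b - a by rewrite subr_gt0.
rewrite /clamp01 /uniform_prob; have [ua|au] := ltP u a.
  rewrite integral_uniform_pdf (_ : _ `&` _ = set0) ?integral_set0; last first.
    apply/seteqP; split => // x [] /=; rewrite !in_itv/= => xu /andP[ax _].
    by have := le_lt_trans (le_trans ax xu) ua; rewrite ltxx.
  rewrite max_l ?min_r//.
  by rewrite pmulr_lle0 ?invr_gt0// subr_le0 ltW.
have d0 : 0 <= (u - a) / (b - a) by rewrite divr_ge0 ?subr_ge0 // ltW.
have [bu|ub] := leP b u.
  rewrite integral_uniform_pdf1 //; last first.
    by move=> x /=; rewrite !in_itv/= => /andP[_ /le_trans->].
  by rewrite max_r// min_l// ler_pdivlMr// mul1r lerD2r.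
rewrite integral_uniform_pdf (_ : _ `&` _ = `[a, u]%classic); last first.
  apply/seteqP; split => x /=; rewrite !in_itv/=.
    by move=> [-> /andP[->]].
  by move=> /andP[-> xu]; rewrite xu (le_trans xu (ltW ub)).
rewrite (eq_integral (fun=> (b - a)^-1%:E)); last first.
  move=> x; rewrite inE/= in_itv/= /uniform_pdf => /andP[-> xu].
  by rewrite (le_trans xu (ltW ub)).
rewrite integral_cst//= lebesgue_measure_itv/= lte_fin max_r//.
rewrite min_r; last by rewrite ler_pdivrMr// mul1r lerD2r ltW.
(* The length of [a, u] reads [u - a] only if [a < u]; otherwise [u = a] and both sides are 0. *)
case: ifPn => [_|]; first by rewrite -EFinD -EFinM mulrC.
rewrite -leNgt => ua; have -> : u = a by apply: le_anti; rewrite ua au.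
by rewrite mule0 subrr mul0r.
Qed.

(* A cumulative function bundles proofs of its properties, so that two
   instances on the same function need not be convertible. *)
Lemma eq_lebesgue_stieltjes_measure (R : realType) (f g : cumulative R R)
    (A : set (measurableTypeR R)) : f =1 g -> measurable A ->
  lebesgue_stieltjes_measure f A = lebesgue_stieltjes_measure g A.
Proof.
(* Uniqueness of the extension reduces the claim to half-open intervals, where the measure is the
   increment [wlength], which depends on the function alone. *)
move=> fg mA; apply: lebesgue_stieltjes_measure_unique => // X oX.
have lsE h : lebesgue_stieltjes_measure h X = wlength h X.
  exact: (measurable_mu_extE (wlength h)).
rewrite [RHS]lsE [LHS]lsE /wlength.
by have -> : (f : R -> R) = g by exact/funext.
Qed.

Lemma lebesgue_stieltjes_Fcdf (R : realType)
    (a : probability (measurableTypeR R) R) (A : set (measurableTypeR R)) :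
  measurable A -> lebesgue_stieltjes_measure (Fcdf a) A = a A.
Proof.
move=> mA; apply: etrans (lebesgue_stieltjes_cdf_id a mA).
exact: eq_lebesgue_stieltjes_measure.
Qed.

(** With k the integer part of x, ramps starting at i < k are saturated, those at i > k vanish, and
    the one at k gives the fractional part. *)
Lemma clamp01_step (R : realType) (x : R) (i : nat) : 0 <= x ->
  clamp01 (x - i%:R) =
    (i < Num.truncn x)%:R + (x - (Num.truncn x)%:R) * (i == Num.truncn x)%:R.
Proof.
move=> x0; have /andP[kx xk] := truncn_itv x0.
set k := Num.truncn x in kx xk *.
rewrite /clamp01; have [ik|ki|->] := ltngtP i k.
- have : i.+1%:R <= k%:R :> R by rewrite ler_nat.
  by rewrite -natr1 mulr0 addr0 => ?; rewrite max_r ?min_l//; lra.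
- have : k.+1%:R <= i%:R :> R by rewrite ler_nat.
  by rewrite mulr0 addr0 => ?; rewrite max_l ?min_r//; lra.
- move: xk; rewrite -natr1 mulr1 add0r => xk.
  by rewrite max_r ?min_r//; lra.
Qed.

Section CdfOfMixture.
Context {R : realType} {N : nat} (Y : 'rV[R]_N).
Hypotheses (hN : (0 < N)%N) (hY : forall i, 0 < Y 0 i).

Lemma Fcdf_mu (s : 'S_N) (u : R) :
  Fcdf (mu_ hN hY s) u =
    \sum_(i < N) Y 0 (s i) / total Y * clamp01 (N%:R * u - i%:R).
Proof.
have N0 : N%:R != 0 :> R by rewrite pnatr_eq0 -lt0n.
rewrite FcdfE /= /mixture -[RHS]/(fine _%:E) -sumEFin.
congr fine; apply: eq_bigr => i _.
(* Dividing by the cell width 1 / N turns the ramp argument into N u - i. *)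
rewrite /= uniform_prob_ray -EFinM -natr1; congr (_ * clamp01 _)%:E.
by field; rewrite N0 addrC addKr oner_eq0.
Qed.

Lemma Fcdf_mu_curve (s : 'S_N) (t : R) : 0 <= t ->
  Fcdf (mu_ hN hY s) t = curve Y s t.
Proof.
move=> t0; have Nt0 : 0 <= N%:R * t by rewrite mulr_ge0.
rewrite Fcdf_mu /curve /interp; set k := Num.truncn _.
have sumE m : \sum_(i < N | (i < m)%N) Y 0 (s i) =
    \sum_(i < N) Y 0 (s i) * (i < m)%:R.
  by rewrite big_mkcond; apply: eq_bigr => i _; case: ifP => _; rewrite (mulr1, mulr0).
(* Both sides become sums over the same i, compared termwise: the slope keeps the difference of the
   indicators of i < k + 1 and i < k, which singles out i = k. *)
rewrite !sumE -mulrBr mulrCA -mulrDr -sumrB mulr_sumr -big_split mulr_sumr.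
apply: eq_bigr => i _ /=.
rewrite clamp01_step // -/k ltnS [(i <= k)%N]leq_eqVlt.
by case: ltngtP => _ /=; ring.
Qed.

Lemma Fcdf_mu_lt0 (s : 'S_N) (u : R) : u < 0 -> Fcdf (mu_ hN hY s) u = 0.
Proof.
move=> u0; rewrite Fcdf_mu big1 // => i _.
have Nu0 : N%:R * u <= 0 by rewrite mulr_ge0_le0 // ltW.
by rewrite /clamp01 max_l ?min_r ?mulr0 // subr_le0 (le_trans Nu0).
Qed.

Lemma Fcdf_mu_gt1 (s : 'S_N) (u : R) : 1 < u -> Fcdf (mu_ hN hY s) u = 1.
Proof.
move=> u1; rewrite Fcdf_mu -[RHS](weight_sum1 hN hY s).
apply: eq_bigr => i _.
(* Every ramp is saturated, since N u - i >= N - i >= 1. *)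
have iN : i.+1%:R <= N%:R :> R by rewrite ler_nat.
have N0 : 0 <= N%:R :> R by [].
have Nu : N%:R <= N%:R * u by rewrite ler_peMr // ltW.
move: iN; rewrite -natr1 => iN.
by rewrite /clamp01 max_r ?min_l ?mulr1 //; lra.
Qed.

End CdfOfMixture.

Theorem proposition7 (R : realType) (N : nat) (ord : 'rV[R]_N -> 'S_N)
    (p : R) (Y Z : 'rV[R]_N)
    (hord : ordering_rule ord) (hp : 0 < p) (hN : (0 < N)%N)
    (hY : forall i, 0 < Y 0 i) (hZ : forall i, 0 < Z 0 i)
    (hYnc : ~ exists c : R, Y = const_mx c) :
  let mu := mu_ hN hY (ord Y) in
  let mustar := mu_ hN hY (ord Z) in
  WRGX ord p Z hN hY =
    1 - CvM p mu mustar /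
        (\int[mu]_(t in `[0, 1]) (`|Lc_ ord Y t - L_ ord Y t| `^ p)).
Proof.
move=> mu mustar; rewrite /WRGX; congr (1 - _ / _).
rewrite /CvM [in RHS]/Rintegral.
rewrite (eq_measure_integral mu); last first.
  by move=> A mA _; exact: lebesgue_stieltjes_Fcdf.
(* Extending the integral over [0, 1] by zero to the whole line leaves a pointwise equality of
   integrands. *)
rewrite -[RHS]/(Rintegral _ _ _) Rintegral_mkcond.
apply: eq_Rintegral => u _; rewrite patchE mem_setE in_itv/=.
case: ifPn => [/andP[u0 _]|].
  by rewrite /mu /mustar !Fcdf_mu_curve // distrC.
have [u0 _|u0] := ltP u 0.
  by rewrite /mu /mustar !Fcdf_mu_lt0 // subrr normr0 powR0 ?gt_eqF.
rewrite /= -ltNge => u1.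
by rewrite /mu /mustar !Fcdf_mu_gt1 // subrr normr0 powR0 ?gt_eqF.
Qed.
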